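(* Let $\{l_1,\dots,l_7\}$ be a set of lines in $L_8$ which forms an $A_6^8(1)$-polytope in $4_{21}$. Then the set of Fano blocks in this $A_6^8(1)$-polytope consists of seven $A_2^8(1)$-polytopes in it. Furthermore, the seven lines together with the Fano blocks form a Steiner system $S(2,3,7)$ (a Fano plane).
   Context: $S_8$ is a del Pezzo surface obtained by blowing up $\mathbb{P}^2$ at $8$ points (with $-K_{S_8}$ ample). $\mathrm{Pic}\,S_8=\mathbb{Z}h\oplus\mathbb{Z}e_1\oplus\dots\oplus\mathbb{Z}e_8$ with intersection form $h^2=1$, $h\cdot e_i=0$, $e_i\cdot e_j=-\delta_{ij}$, and $K_{S_8}=-3h+\sum_{i=1}^8 e_i$. A line is a class $l\in\mathrm{Pic}\,S_8$ with $l^2=l\cdot K_{S_8}=-1$; $L_8$ is the set of lines, which is the vertex set of the Gosset polytope $4_{21}$ (the convex hull of $L_8$). An $A_n^8(1)$-polytope in $4_{21}$ is a set of $n+1$ distinct lines in $L_8$ with pairwise intersection number $1$. The vertex figure of $l\in L_8$ is $\{l'\in L_8: l'\cdot l=0\}$. An $A_n^8(1)$-polytope is cornered if there is a line $l\in L_8$ whose vertex figure contains all its lines. A Fano block in an $A_6^8(1)$-polytope $P$ is a three-element subset of $P$ (an $A_2^8(1)$-polytope) that is not contained in any four-element subset of $P$ which is a cornered $A_3^8(1)$-polytope. A Steiner system $S(2,3,7)$ on a $7$-element set is a family of $3$-element subsets (blocks) such that every $2$-element subset is contained in exactly one block. *)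

(* Defs.v *)
From mathcomp Require Import all_boot all_order all_algebra.
From mathcomp Require Import finmap boolp.

Set Implicit Arguments.
Unset Strict Implicit.
Unset Printing Implicit Defensive.

Import Order.TTheory GRing.Theory Num.Theory.

Local Open Scope fset_scope.
Local Open Scope ring_scope.

(* The Picard lattice of the blow-up of P^2 at 8 points: a divisor class is
   its row of coordinates in the basis (h, e_1, ..., e_8), with h at index 0
   and e_(i+1) at index i+1 for i : 'I_8.  Lines, polytopes and Fano blocks
   depend on the surface only through this lattice and its canonical class. *)
Notation pic8 := 'rV[int]_9.

Definition pic_h : pic8 := delta_mx 0 ord0.
Definition pic_e (i : 'I_8) : pic8 := delta_mx 0 (lift ord0 i).

Definition inter (D E : pic8) : int :=
  D 0 ord0 * E 0 ord0
  - \sum_(i < 8) D 0 (lift ord0 i) * E 0 (lift ord0 i).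

Definition canonical8 : pic8 := - (pic_h *+ 3) + \sum_(i < 8) pic_e i.

Lemma inter_hh : inter pic_h pic_h = 1.
Proof.
by rewrite /inter big1 => [|i _]; rewrite !mxE ?eqxx ?mulr1 ?subr0 ?mul0r.
Qed.

Lemma inter_he (i : 'I_8) : inter pic_h (pic_e i) = 0.
Proof.
by rewrite /inter big1 => [|j _]; rewrite !mxE ?mulr0 ?mul0r ?subr0.
Qed.

Lemma inter_ee (i j : 'I_8) : inter (pic_e i) (pic_e j) = - (i == j)%:R.
Proof.
rewrite /inter !mxE /= mul0r add0r; congr (- _).
rewrite (bigD1 i) //= big1 => [|k ki]; last first.
  by rewrite !mxE (inj_eq lift_inj) (negbTE ki) mul0r.
by rewrite !mxE !eqxx (inj_eq lift_inj) mul1r addr0.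
Qed.

Definition L8 : {pred pic8} :=
  [pred l | (inter l l == -1) && (inter l canonical8 == -1)].

Definition vertex_figure (l : pic8) : {pred pic8} :=
  [pred l' | (l' \in L8) && (inter l' l == 0)].

(* A_n^8(1)-polytopes, given by their sets of n + 1 vertices. *)
Definition A_polytope (n : nat) (P : {fset pic8}) : Prop :=
  [/\ #|` P| = n.+1,
      {subset P <= L8} &
      {in P &, forall l l' : pic8, l != l' -> inter l l' = 1}].

Definition cornered (P : {fset pic8}) : Prop :=
  exists2 l : pic8, l \in L8 & {subset P <= vertex_figure l}.

Definition fano_block (P B : {fset pic8}) : Prop :=
  [/\ B `<=` P,
      #|` B| = 3%N &
      forall Q : {fset pic8},
        Q `<=` P -> A_polytope 3 Q -> cornered Q -> ~~ (B `<=` Q)].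

Definition fano_blocks (P : {fset pic8}) : {fset {fset pic8}} :=
  [fset B in fpowerset P | `[< fano_block P B >]].

(* Steiner systems S(t, k, v) on the point set X. *)
Definition steiner_system (T : choiceType) (t k v : nat)
    (X : {fset T}) (F : {fset {fset T}}) : Prop :=
  [/\ #|` X| = v,
      forall B : {fset T}, B \in F -> B `<=` X /\ #|` B| = k &
      forall S : {fset T}, S `<=` X -> #|` S| = t ->
        exists! B : {fset T}, B \in F /\ S `<=` B].

(* Main.v *)
Require Import Defs.
From mathcomp Require Import all_boot all_order all_algebra.
From mathcomp Require Import finfield mxabelem.
From mathcomp Require Import finmap boolp.
From mathcomp Require Import ring zify.

(** Translating by the canonical class K turns a line l into l + K, a root of
    the even negative definite lattice K^perp (a copy of E_8), because
    (l + K).(m + K) = l.m - 1.  Seven lines that pairwise meet once become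
    seven pairwise orthogonal roots a_0, ..., a_6.

    Four of the lines lie in a common vertex figure exactly when half the sum
    of the four corresponding roots is integral: a line m that misses all four
    gives a root m + K of product -1 with each of them, and since K^perp is
    definite this forces the sum of the four roots to be 2(m + K)
    ([cornered_halvable]).  So the cornered quadruples belong to the family of
    index sets S for which the sum of the a_i, i in S, is divisible by two.
    These sets form a binary code of length seven, whose words have weight
    divisible by four since K^perp is even ([half_sum_weight]), and meet in
    an even number of indices since products of half-sums are integers
    ([half_sum_meet]).  Two distinct cornered quadruples thus meet in exactly
    two lines.

    The code is large: modulo two, the roots span a totally isotropic
    subspace of F_2^9, which has dimension at most four, so the relations
    between the seven roots form a space of dimension at least three
    ([card_halvable_ge]).  Its nonzero words have weight four, so there are at
    least seven cornered quadruples ([card_corner_quads]).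

    The rest is counting.  Two lines belong to at most two cornered
    quadruples, because such quadruples take up disjoint pairs among the five
    other lines; as 6 * 7 = 2 * 21, the bound is attained at every pair.  The
    two quadruples through a given pair cover six of the seven lines, and the
    missing line is the only one that completes the pair to a Fano block
    ([quad_free_through_pair]).  Counting pairs inside blocks, there are
    21 / 3 = 7 Fano blocks ([card_quad_free]). *)

Set Implicit Arguments.
Unset Strict Implicit.
Unset Printing Implicit Defensive.

Import Order.TTheory GRing.Theory Num.Theory.

Local Open Scope fset_scope.

(** * Triples avoiding a system of quadruples on seven points *)

(** Double counting of the pairs (S, A) with S a k-subset of A. *)
Lemma sum_bin_card_draws (T : finType) (F : {set {set T}}) (k : nat) :
  \sum_(A in F) 'C(#|A|, k) =
  \sum_(S : {set T} | #|S| == k) #|[set A in F | S \subset A]|.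
Proof.
transitivity (\sum_(A in F) \sum_(S : {set T} | (#|S| == k) && (S \subset A)) 1).
  apply: eq_bigr => A _; rewrite -(@cards_draws _ A) -sum1_card.
  by apply: eq_bigl => B; rewrite inE andbC.
rewrite (exchange_big_dep (fun S : {set T} => #|S| == k)) => [|A S _ /andP[] //].
apply: eq_bigr => S /eqP cS; rewrite -[RHS]sum1_card; apply: eq_bigl => A.
by rewrite inE cS eqxx.
Qed.

Section QuadSystem.
Variables (T : finType) (E : {set {set T}}).
Hypotheses (cardT : #|T| = 7) (geE : 7 <= #|E|).
Hypothesis quad : {in E, forall A : {set T}, #|A| = 4}.
Hypothesis quadI : {in E &, forall A B : {set T}, A != B -> #|A :&: B| = 2}.

Definition quad_free : {set {set T}} :=
  [set B : {set T} | (#|B| == 3) && [forall A in E, ~~ (B \subset A)]].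

(** The members of E through S remove disjoint pairs from the five points
    outside S. *)
Lemma quads_through_pair_le (S : {set T}) :
  #|S| = 2 -> #|[set A in E | S \subset A]| <= 2.
Proof.
move=> cS; set ES := [set A in E | S \subset A].
(* Two members of E sharing S and a further point would share three points. *)
have tri (x : T) : x \in ~: S -> \sum_(A in ES | x \in A) 1 <= 1.
  rewrite inE sum1dep_card => xS; apply/card_le1_eqP => A B.
  rewrite !inE => /andP[/andP[AE SA] xA] /andP[/andP[BE SB] xB].
  apply/eqP; apply: contraT => nAB.
  suff: 2 < #|A :&: B| by rewrite setIC quadI.
  rewrite -cS; apply/proper_card/properP; split; first by rewrite subsetI SA SB.
  by exists x => //; rewrite inE xA xB.
have : \sum_(A in ES) #|A :\: S| <= #|~: S|.
  rewrite -[#|~: S|]sum1_card.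
  under eq_bigr => A _ do rewrite -sum1_card.
  rewrite (exchange_big_dep (mem (~: S))) /=; last first.
    by move=> A x _; rewrite !inE => /andP[].
  apply: leq_sum => x xS; apply: leq_trans (tri x xS).
  by apply/eq_leq/eq_bigl => A; rewrite !inE in xS *; rewrite xS.
rewrite (cardsCs (~: S)) setCK cardT cS.
rewrite (eq_bigr (fun=> 2)) ?sum_nat_const; first lia.
move=> A; rewrite inE => /andP[AE SA].
by rewrite cardsD (setIidPr SA) quad // cS.
Qed.

(** The members of E contain at least 7 * 6 pairs in total, and there are
    'C(7, 2) = 21 pairs, each counted at most twice: no count can fall short. *)
Lemma quads_through_pair (S : {set T}) :
  #|S| = 2 -> #|[set A in E | S \subset A]| = 2.
Proof.
have le2 (R : {set T}) : #|R| == 2 ->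
    #|[set A in E | R \subset A]| <= 2
      ?= iff (#|[set A in E | R \subset A]| == 2).
  by move=> /eqP /quads_through_pair_le le; split.
have := leqif_sum le2.
rewrite -sum_bin_card_draws (eq_bigr (fun=> 6)); last by move=> A /quad ->.
rewrite sum_nat_const sum_nat_cond_const card_draws cardT => -[le42 eqC].
have /forall_inP all2 : [forall (R : {set T} | #|R| == 2),
    #|[set A in E | R \subset A]| == 2].
  by rewrite -eqC eqn_leq le42 (leq_mul2r 6 7).
by move=> /eqP /all2 /eqP.
Qed.

(** The two members of E through S cover 4 + 4 - 2 = 6 points.  A third point
    completes S to a triple inside no member of E only if it is the uncovered
    one. *)
Lemma quad_free_through_pair (S : {set T}) :
  #|S| = 2 -> #|[set B in quad_free | S \subset B]| = 1.
Proof.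
move=> cS; have /eqP/cards2P[A1 [A2 [nA12 defES]]] := quads_through_pair cS.
have inES A : (A \in E) && (S \subset A) = (A == A1) || (A == A2).
  by move/setP/(_ A): defES; rewrite !inE.
have /andP[A1E SA1] : (A1 \in E) && (S \subset A1) by rewrite inES eqxx.
have /andP[A2E SA2] : (A2 \in E) && (S \subset A2) by rewrite inES eqxx orbT.
have /eqP/cards1P[x defx] : #|~: (A1 :|: A2)| = 1.
  by rewrite cardsCs setCK cardT cardsU (quad A1E) (quad A2E) quadI.
have xU y : (y \notin A1 :|: A2) = (y == x).
  by move/setP/(_ y): defx; rewrite !inE.
have /negbT xS : x \in S = false.
  apply: contraTF (eqxx x) => /(subsetP SA1) xA1.
  by rewrite -xU inE xA1.
suff -> : [set B in quad_free | S \subset B] = [set x |: S] by rewrite cards1.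
apply/setP=> B; rewrite !inE; apply/andP/eqP => [[/andP[/eqP cB freeB] SB]|->].
  move/forall_inP in freeB.
  have /eqP/cards1P[y defy] : #|B :\: S| = 1.
    by rewrite cardsD (setIidPr SB) cB cS.
  have defB : B = y |: S by rewrite -defy setUC -{1}(setID B S) (setIidPr SB).
  suff /eqP <- : y == x by [].
  rewrite -xU inE negb_or; apply/andP; split.
    by apply: contra (freeB _ A1E) => yA; rewrite defB subUset sub1set yA.
  by apply: contra (freeB _ A2E) => yA; rewrite defB subUset sub1set yA.
split; last exact: subsetUr.
rewrite cardsU1 xS cS /=; apply/forall_inP => A AE.
rewrite subUset sub1set; apply/negP => /andP[xA SA].
have := xU x; rewrite eqxx inE.
have : (A == A1) || (A == A2) by rewrite -inES AE.
by case/orP=> /eqP <-; rewrite xA ?orbT.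
Qed.

Lemma card_quad_free : #|quad_free| = 7.
Proof.
have := sum_bin_card_draws quad_free 2; rewrite (eq_bigr (fun=> 3)); last first.
  by move=> B; rewrite inE => /andP[/eqP -> _].
rewrite [RHS](eq_bigr (fun=> 1)); last by move=> S /eqP/quad_free_through_pair.
rewrite sum_nat_const sum_nat_cond_const card_draws cardT.
rewrite (_ : 'C(7, 2) = 21) //; lia.
Qed.

End QuadSystem.

(** * Index sets and finite subsets of a choice type *)

Section FiniteImage.
Variables (I : finType) (T : choiceType) (f : I -> T).
Hypothesis f_inj : injective f.

Definition fimage (S : {set I}) : {fset T} := [fset f i | i in S].

Lemma mem_fimage i S : (f i \in fimage S) = (i \in S).
Proof.
by apply/imfsetP/idP => [[j jS /f_inj ->]|iS]; last exists i.
Qed.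

Lemma card_fimage S : #|` fimage S| = #|S|.
Proof. by rewrite card_imfset //= cardE. Qed.

Lemma fimage_sub S1 S2 : (fimage S1 `<=` fimage S2) = (S1 \subset S2).
Proof.
apply/fsubsetP/subsetP => [sub i|sub _ /imfsetP[i /= iS ->]].
  by rewrite -!mem_fimage => /sub.
by rewrite mem_fimage sub.
Qed.

Lemma fimage_inj : injective fimage.
Proof. by move=> S1 S2 eqS; apply/setP => i; rewrite -!mem_fimage eqS. Qed.

Lemma fimage_preim (B : {fset T}) :
  B `<=` fimage setT -> exists S, B = fimage S.
Proof.
move=> /fsubsetP sub; exists [set i | f i \in B].
apply/fsetP => x; apply/idP/imfsetP => [xB|[i]].
  by have /imfsetP[i _ def_x] := sub x xB; exists i; rewrite // inE -def_x.
by rewrite /= inE => fiB ->.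
Qed.

Lemma steiner_fimage (t k : nat) (F : {set {set I}}) :
    {in F, forall B : {set I}, #|B| = k} ->
    (forall S : {set I}, #|S| = t -> #|[set B in F | S \subset B]| = 1) ->
  steiner_system t k #|I| (fimage setT) [fset fimage B | B in F].
Proof.
move=> cardF F1; split; first by rewrite card_fimage cardsT.
  move=> _ /imfsetP[B /= BF ->].
  by rewrite fimage_sub subsetT card_fimage cardF.
move=> _ /fimage_preim[S ->]; rewrite card_fimage.
move=> /F1/eqP/cards1P[B /setP defB].
have /andP[BF SB] : (B \in F) && (S \subset B).
  by have := defB B; rewrite !inE eqxx.
exists (fimage B); split.
  by split; [apply/imfsetP; exists B | rewrite fimage_sub].
move=> _ [/imfsetP[C /= CF ->]]; rewrite fimage_sub => SC.
by have := defB C; rewrite !inE CF SC => /esym/eqP ->.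
Qed.

End FiniteImage.

(** * The intersection form *)

Section PicardLattice.
Local Open Scope ring_scope.
Local Notation K := canonical8.

Lemma interC (x y : pic8) : inter x y = inter y x.
Proof. by congr (_ - _); [|apply: eq_bigr => i _]; rewrite mulrC. Qed.

Lemma interDl (x y z : pic8) : inter (x + y) z = inter x z + inter y z.
Proof.
rewrite /inter mxE mulrDl; under eq_bigr => i _ do rewrite mxE mulrDl.
by rewrite big_split /= opprD addrACA.
Qed.

Lemma interDr (x y z : pic8) : inter z (x + y) = inter z x + inter z y.
Proof. by rewrite !(interC z) interDl. Qed.

Lemma inter0l (x : pic8) : inter 0 x = 0.
Proof. by apply: (addrI (inter 0 x)); rewrite -interDl !addr0. Qed.

Lemma interNl (x y : pic8) : inter (- x) y = - inter x y.
Proof. by apply: (addrI (inter x y)); rewrite -interDl !subrr inter0l. Qed.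

Lemma interNr (x y : pic8) : inter y (- x) = - inter y x.
Proof. by rewrite !(interC y) interNl. Qed.

Lemma inter_suml (I : finType) (A : pred I) (f : I -> pic8) (x : pic8) :
  inter (\sum_(i | A i) f i) x = \sum_(i | A i) inter (f i) x.
Proof.
by apply: (big_morph (inter^~ x)) => [y z|]; rewrite (inter0l, interDl).
Qed.

Lemma canonical8_coord (j : 'I_9) : K 0 j = if j == ord0 then - 3 else 1.
Proof.
rewrite !mxE summxE; case: (unliftP ord0 j) => [k ->|->] /=.
  rewrite (bigD1 k) //= big1 => [|i ik]; last first.
    by rewrite !mxE (inj_eq lift_inj) eq_sym (negbTE ik).
  by rewrite !mxE !eqxx.
by rewrite big1 // => i _; rewrite !mxE.
Qed.

Lemma inter_canonical8 (x : pic8) :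
  inter x K = - 3 * x 0 ord0 - \sum_(i < 8) x 0 (lift ord0 i).
Proof.
rewrite /inter canonical8_coord /= mulrC; congr (_ - _).
by apply: eq_bigr => i _; rewrite canonical8_coord mulr1.
Qed.

Lemma inter_KK : inter K K = 1.
Proof.
rewrite inter_canonical8; under eq_bigr => i _ do rewrite canonical8_coord.
by rewrite canonical8_coord sumr_const card_ord.
Qed.

(** The form is negative definite on the orthogonal of K.  If v = (d; m) has
    v.K = 0, then the sum of the m_i is -3d; if also v.v = 0, then the sum of
    the m_i ^ 2 is d ^ 2.  Expanding the squares (3 m_i + d) ^ 2 and adding
    them up gives - d ^ 2, whence d = 0 and then every m_i = 0. *)
Lemma canonical8_orth_definite (v : pic8) :
  inter v K = 0 -> inter v v = 0 -> v = 0.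
Proof.
rewrite inter_canonical8 /inter; set d := v 0 ord0 => vK vv.
have sq0 : d * d + \sum_(i < 8) (3 * v 0 (lift ord0 i) + d) ^+ 2 = 0.
  transitivity (d * d + 9 * \sum_(i < 8) v 0 (lift ord0 i) * v 0 (lift ord0 i)
      + 6 * d * (\sum_(i < 8) v 0 (lift ord0 i)) + 8 * (d * d)); last first.
    have -> : \sum_(i < 8) v 0 (lift ord0 i) = - 3 * d by lia.
    have <- : d * d = \sum_(i < 8) v 0 (lift ord0 i) * v 0 (lift ord0 i) by lia.
    by ring.
  rewrite !mulr_sumr -!addrA; congr (_ + _).
  have -> : 8 * (d * d) = \sum_(i < 8) d * d.
    by rewrite sumr_const card_ord mulr_natl.
  by rewrite -!big_split /=; apply: eq_bigr => i _; ring.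
have sq_ge0 (i : 'I_8) : true -> 0 <= (3 * v 0 (lift ord0 i) + d) ^+ 2.
  by rewrite sqr_ge0.
move/eqP: sq0; rewrite paddr_eq0 -?expr2 ?sqr_ge0 ?sumr_ge0 // sqrf_eq0.
move=> /andP[/eqP d0 /eqP/(psumr_eq0P sq_ge0) v_eq0].
apply/rowP => j; rewrite mxE; case: (unliftP ord0 j) => [k ->|-> //].
by have /eqP := v_eq0 k isT; rewrite sqrf_eq0 d0 addr0 mulf_eq0 => /eqP.
Qed.

(** * Reduction modulo two *)

Lemma F2_sqr (z : 'F_2) : z * z = z.
Proof. by have := expf_card z; rewrite card_Fp // expr2. Qed.

Lemma F2_opp (z : 'F_2) : - z = z.
Proof. exact/oppr_pchar2/pchar_Fp. Qed.

Lemma F2_neq0 (z : 'F_2) : z = (z != 0)%:R.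
Proof.
have /eqP : z * (z - 1) = 0 by rewrite mulrBr F2_sqr mulr1 subrr.
by rewrite mulf_eq0 subr_eq0 => /orP[] /eqP ->; rewrite ?eqxx ?oner_eq0.
Qed.

Lemma F2_eq0 (n : int) : (n%:~R == 0 :> 'F_2) = (2 %| n)%Z.
Proof. by rewrite -(dvdz_pcharf (pchar_Fp (isT : prime 2))). Qed.

(** Signs disappear modulo two, so the form becomes the standard dot product. *)
Lemma inter_mod2 (x y : pic8) :
  (inter x y)%:~R = \sum_j (x 0 j)%:~R * (y 0 j)%:~R :> 'F_2.
Proof.
rewrite big_ord_recl /inter rmorphB /= rmorphM F2_opp rmorph_sum; congr (_ + _).
by apply: eq_bigr => j _; rewrite rmorphM.
Qed.

(** K is a characteristic vector, all its coordinates being odd; hence the form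
    is even on the orthogonal of K. *)
Lemma inter_self_mod2 (x : pic8) :
  (inter x x)%:~R = (inter x K)%:~R :> 'F_2.
Proof.
rewrite !inter_mod2; apply: eq_bigr => j _.
suff -> : (K 0 j)%:~R = 1 :> 'F_2 by rewrite F2_sqr mulr1.
by rewrite canonical8_coord; case: eqP => _; apply/val_inj.
Qed.

(** * The code of a family of orthogonal roots *)

Section OrthogonalRoots.
Variables (n : nat) (a : 'I_n -> pic8).
Hypothesis aK : forall i, inter (a i) K = 0.
Hypothesis aa : forall i j, inter (a i) (a j) = if i == j then - 2 else 0.

Definition half_sum (S : {set 'I_n}) (r : pic8) : Prop :=
  \sum_(i in S) a i = r + r.

Lemma half_sumK S r : half_sum S r -> inter r K = 0.
Proof.
move=> Sr; suff : inter r K + inter r K = 0 by lia.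
by rewrite -interDl -Sr inter_suml big1.
Qed.

Lemma half_sum_root S r j : half_sum S r -> inter r (a j) = - (j \in S)%:R.
Proof.
move=> Sr; have : inter r (a j) + inter r (a j) = - 2 * (j \in S)%:R.
  rewrite -interDl -Sr inter_suml; case: (boolP (j \in S)) => jS.
    rewrite (bigD1 j) //= aa eqxx big1 // => i /andP[_ /negbTE ij].
    by rewrite aa ij.
  by rewrite big1 // => i iS; rewrite aa; case: eqP iS jS => // -> ->.
lia.
Qed.

Lemma half_sum_inter S T r s : half_sum S r -> half_sum T s ->
  inter r s *+ 2 = - #|S :&: T|%:R.
Proof.
move=> Sr Ts; rewrite mulr2n -interDr -Ts interC inter_suml.
rewrite (eq_bigr (fun i => - (i \in S)%:R)) => [|i _]; last first.
  by rewrite interC (half_sum_root _ Sr).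
rewrite sumrN -sumr_const; congr (- _).
rewrite [RHS]big_mkcond [LHS]big_mkcond; apply: eq_bigr => i _.
by rewrite inE andbC; case: (i \in T); case: (i \in S).
Qed.

(** The norm of the half-sum is - #|S| / 2, and it is even. *)
Lemma half_sum_weight S r : half_sum S r -> (4 %| #|S|)%N.
Proof.
move=> Sr; have := half_sum_inter Sr Sr; rewrite setIid.
have : (2 %| inter r r)%Z by rewrite -F2_eq0 inter_self_mod2 (half_sumK Sr).
by move=> /dvdzP[q ->]; lia.
Qed.

(** The product of the two half-sums is the integer - #|S :&: T| / 2. *)
Lemma half_sum_meet S T r s : half_sum S r -> half_sum T s -> ~~ odd #|S :&: T|.
Proof. by move=> Sr Ts; have := half_sum_inter Sr Ts; lia. Qed.

Definition halvable (S : {set 'I_n}) : bool :=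
  [forall j, (2 %| (\sum_(i in S) a i) 0%R j)%Z].

Lemma halvableP S : reflect (exists r, half_sum S r) (halvable S).
Proof.
apply: (iffP forallP) => [S2|[r Sr] j]; last first.
  by rewrite Sr mxE; apply/dvdzP; exists (r 0 j); rewrite mulz2.
exists (\row_j ((\sum_(i in S) a i) 0%R j %/ 2)%Z); apply/rowP => j.
by rewrite !mxE -mulz2 divzK.
Qed.

Definition mod2_mx : 'M['F_2]_(n, 9) := \matrix_(i, j) (a i 0 j)%:~R.

(** The rows span a totally isotropic subspace of F_2^9, and 4 = 9./2. *)
Lemma mod2_mx_rank : (\rank mod2_mx <= 4)%N.
Proof.
suff /mulmx0_rank_max : mod2_mx *m mod2_mx^T = 0 by rewrite mxrank_tr; lia.
apply/matrixP => i k; rewrite !mxE.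
transitivity ((inter (a i) (a k))%:~R : 'F_2).
  by rewrite inter_mod2; apply: eq_bigr => j _; rewrite !mxE.
by rewrite aa; case: eqP => _; apply/val_inj.
Qed.

(** A halvable set is the support of a linear relation between the roots
    modulo two, and over F_2 a relation is determined by its support. *)
Lemma card_halvable_ge : (2 ^ (n - 4) <= #|[set S | halvable S]|)%N.
Proof.
pose supp (u : 'rV['F_2]_n) : {set 'I_n} := [set i | u 0 i != 0].
have suppE (u : 'rV['F_2]_n) i : u 0 i = (i \in supp u)%:R.
  by rewrite inE -F2_neq0.
have supp_inj : injective supp.
  by move=> u v uv; apply/rowP => i; rewrite !suppE uv.
have cardK : #|supp @: rowg (kermx mod2_mx)| = (2 ^ (n - \rank mod2_mx))%N.
  by rewrite card_imset // card_rowg mxrank_ker card_Fp.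
apply: (@leq_trans #|supp @: rowg (kermx mod2_mx)|).
  by rewrite cardK leq_exp2l // leq_sub2l // mod2_mx_rank.
apply/subset_leq_card/subsetP => _ /imsetP[u uK ->].
rewrite inE; apply/forallP => j; rewrite summxE -F2_eq0 rmorph_sum /=.
move: uK; rewrite mem_rowg => /sub_kermxP/rowP/(_ j); rewrite !mxE => uA0.
apply/eqP; rewrite -[RHS]uA0 big_mkcond; apply: eq_bigr => i _.
by rewrite [u 0 i]suppE mxE; case: (i \in supp u); rewrite ?mul1r ?mul0r.
Qed.

End OrthogonalRoots.

(** * Lines as translated roots *)

Lemma lineP (l : pic8) :
  reflect (inter l l = - 1 /\ inter l K = - 1) (l \in L8).
Proof. by apply: (iffP andP) => -[/eqP ? /eqP ?]. Qed.

(** Since l.K = m.K = -1 and K.K = 1. *)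
Lemma inter_add_canonical8 (l m : pic8) : l \in L8 -> m \in L8 ->
  inter (l + K) (m + K) = inter l m - 1.
Proof.
move=> /lineP[_ lK] /lineP[_ mK].
by rewrite interDl !(interDr m) (interC K m) lK mK inter_KK; lia.
Qed.

Section Lines.
Variables (n : nat) (l : 'I_n -> pic8).
Hypothesis lL : forall i, l i \in L8.
Hypothesis ll : forall i j, i != j -> inter (l i) (l j) = 1.
Let a i := l i + K.

Lemma root_canonical8 i : inter (a i) K = 0.
Proof. by rewrite interDl inter_KK; have /lineP[_ ->] := lL i. Qed.

Lemma root_inter i j : inter (a i) (a j) = if i == j then - 2 else 0.
Proof.
rewrite inter_add_canonical8 //; case: eqP => [<-|/eqP/ll -> //].
by have /lineP[-> _] := lL i.
Qed.

(** A line that misses the four lines corresponds to a root r with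
    r.(a i) = -1 for i in S, and half the sum of these a i is the only such
    root. *)
Lemma cornered_halvable (S : {set 'I_n}) : #|S| = 4 ->
  cornered (fimage l S) <-> halvable a S.
Proof.
move=> cS; split=> [[m mL lm]|/halvableP[r Sr]].
  have [r [rK rr ra]] : exists r, [/\ inter r K = 0, inter r r = - 2 &
      forall i, i \in S -> inter (a i) r = - 1].
    have /lineP[mm mK] := mL; exists (m + K).
    split=> [||i iS]; first by rewrite interDl mK inter_KK.
      by rewrite inter_add_canonical8 // mm.
    have /andP[_ /eqP lim] : l i \in vertex_figure m.
      by apply: lm; apply/imfsetP; exists i.
    by rewrite inter_add_canonical8 // lim.
  apply/halvableP; exists r.
  rewrite /half_sum; set s := \sum_(i in S) a i.
  have sE x c : (forall i, i \in S -> inter (a i) x = c) -> inter s x = c *+ 4.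
    by move=> ax; rewrite inter_suml (eq_bigr _ ax) sumr_const cS.
  have sK : inter s K = 0 by rewrite (sE _ 0) // => i _; exact: root_canonical8.
  have sr : inter s r = - 4 by rewrite (sE _ _ ra).
  have ss : inter s s = - 8.
    rewrite (sE _ (- 2)) // => i iS; rewrite interC inter_suml (bigD1 i) //=.
    rewrite root_inter eqxx big1 // => j /andP[_ /negbTE ji].
    by rewrite root_inter ji.
  (* s - 2r is orthogonal to K and has norm -8 - 4 (-4) + 4 (-2) = 0. *)
  apply/eqP; rewrite -subr_eq0; apply/eqP/canonical8_orth_definite.
    by rewrite interDl interNl interDl rK sK.
  rewrite interDl interNl !interDr !interNr !(interDr r) !(interDl r).
  by rewrite (interC r s) ss sr rr.
have rK := half_sumK root_canonical8 Sr.
have rr : inter r r = - 2.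
  by have := half_sum_inter root_inter Sr Sr; rewrite setIid cS; lia.
have mL : r - K \in L8.
  apply/lineP; rewrite !(interDl r) (interDr r) !interNl interDr !interNr.
  by rewrite (interC K r) rr rK inter_KK.
exists (r - K) => // _ /imfsetP[i /= iS ->]; apply/andP; split=> //.
apply/eqP; have := inter_add_canonical8 (lL i) mL.
by rewrite subrK interC (half_sum_root root_inter _ Sr) iS; lia.
Qed.

End Lines.

End PicardLattice.

(** * The Fano plane *)

Lemma A_polytope_sub (m n : nat) (P Q : {fset pic8}) :
  A_polytope n P -> Q `<=` P -> #|` Q| = m.+1 -> A_polytope m Q.
Proof.
move=> [_ PL P1] /fsubsetP QP cQ; split=> // [x /QP/PL //|x y /QP xP /QP yP].
exact: P1.
Qed.

Section SevenLines.
Variable l : 'I_7 -> pic8.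
Hypothesis l_inj : injective l.
Hypothesis lL : forall i, l i \in L8.
Hypothesis ll : forall i j, i != j -> inter (l i) (l j) = 1%R.
Let a i : pic8 := (l i + canonical8)%R.

Definition corner_quads : {set {set 'I_7}} :=
  [set S : {set 'I_7} | (#|S| == 4) && halvable a S].

(** A nonempty word has weight at most 7 and divisible by 4, so all
    2 ^ (7 - 4) - 1 nonempty words found have weight 4. *)
Lemma card_corner_quads : 7 <= #|corner_quads|.
Proof.
have ge8 : 8 <= #|[set S | halvable a S]|.
  exact: card_halvable_ge (root_inter lL ll).
have : #|[set S | halvable a S] :\ set0| <= #|corner_quads|.
  apply/subset_leq_card/subsetP => S; rewrite !inE => /andP[S0 hS].
  rewrite hS andbT; case/halvableP: hS => r Sr.
  have := half_sum_weight (root_canonical8 lL) (root_inter lL ll) Sr.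
  have := max_card S; rewrite card_ord -cards_eq0 in S0 *.
  by move: #|S| S0; do 8 case=> //.
apply: leq_trans; move: ge8; rewrite (cardsD1 set0).
by case: (_ \in _) => //=; lia.
Qed.

(** The intersection has even size, less than 4, and at least 4 + 4 - 7 = 1. *)
Lemma corner_quadsI :
  {in corner_quads &, forall A B : {set 'I_7}, A != B -> #|A :&: B| = 2}.
Proof.
move=> A B; rewrite !inE => /andP[/eqP cA /halvableP[r Ar]].
move=> /andP[/eqP cB /halvableP[s Bs]] nAB.
have := half_sum_meet (root_inter lL ll) Ar Bs.
have := max_card (A :|: B); rewrite card_ord cardsU cA cB.
have : #|A :&: B| < 4.
  rewrite -[ltnRHS]cA; apply/proper_card; rewrite properEneq subsetIl andbT.
  apply: contra nAB => /eqP/setIidPl AB.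
  by rewrite eqEcard AB cA cB.
by move: #|A :&: B|; do 4 case=> //.
Qed.

Lemma fano_block_quad_free (B : {set 'I_7}) :
  A_polytope 6 (fimage l setT) ->
  fano_block (fimage l setT) (fimage l B) <-> B \in quad_free corner_quads.
Proof.
move=> polP; rewrite inE.
split=> [[_ cB freeB]|/andP[/eqP cB /forall_inP freeB]].
  apply/andP; split; first by rewrite -(card_fimage l_inj) cB.
  apply/forall_inP => A; rewrite inE => /andP[/eqP cA hA].
  have AP : fimage l A `<=` fimage l setT by rewrite fimage_sub // subsetT.
  rewrite -(fimage_sub l_inj); apply: freeB => //; last exact/cornered_halvable.
  by apply: A_polytope_sub polP AP _; rewrite card_fimage.
split; rewrite ?fimage_sub ?subsetT ?card_fimage //.
move=> _ /fimage_preim[A ->] [cA _ _]; rewrite card_fimage // in cA.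
move=> /(cornered_halvable lL ll cA) hA.
by rewrite fimage_sub // freeB // inE cA eqxx.
Qed.

End SevenLines.

Theorem theorem28 (P : {fset pic8}) (hP : A_polytope 6 P) :
  [/\ #|` fano_blocks P| = 7%N,
      forall B : {fset pic8}, B \in fano_blocks P ->
        B `<=` P /\ A_polytope 2 B &
      steiner_system 2 3 7 P (fano_blocks P)].
Proof.
have [cP PL P1] := hP.
pose l (i : 'I_7) : pic8 := nth 0%R P i.
have lt_i (i : 'I_7) : i < size P by rewrite cP.
have lP i : l i \in P by exact: mem_nth.
have l_inj : injective l.
  by move=> i j /eqP; rewrite nth_uniq ?fset_uniq // => /eqP/val_inj.
have lL i : l i \in L8 by exact: PL.
have ll i j : i != j -> inter (l i) (l j) = 1%R.
  by move=> ij; apply: P1; rewrite ?(inj_eq l_inj).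
have defP : fimage l setT = P.
  apply/eqP; rewrite eqEfcard card_fimage // cardsT card_ord cP leqnn andbT.
  by apply/fsubsetP => _ /imfsetP[i _ ->].
have quad : {in corner_quads l, forall A : {set 'I_7}, #|A| = 4}.
  by move=> A; rewrite inE => /andP[/eqP].
have c7 := card_corner_quads lL ll; have cI := corner_quadsI lL ll.
have polP : A_polytope 6 (fimage l setT) by rewrite defP.
have blocksE :
    fano_blocks P = [fset fimage l B | B in quad_free (corner_quads l)].
  apply/fsetP => B; apply/idP/imfsetP => [|[S /= freeS ->]].
    rewrite !inE /= fpowersetE -defP => /andP[/fimage_preim[S ->]] /asboolP blS.
    by exists S => //=; apply/(fano_block_quad_free l_inj lL ll S polP).
  rewrite !inE /= fpowersetE -defP fimage_sub // subsetT; apply/asboolP.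
  exact/(fano_block_quad_free l_inj lL ll S polP).
rewrite blocksE; split.
- rewrite card_imfset /=; last exact: fimage_inj.
  by rewrite -cardE card_quad_free ?card_ord.
- move=> _ /imfsetP[B /= freeB ->].
  have BP : fimage l B `<=` P by rewrite -defP fimage_sub // subsetT.
  split=> //; apply: A_polytope_sub hP BP _; rewrite card_fimage //.
  by move: freeB; rewrite inE => /andP[/eqP].
have := steiner_fimage l_inj (t := 2) (k := 3) (F := quad_free (corner_quads l)).
rewrite card_ord defP; apply=> [B|S]; first by rewrite inE => /andP[/eqP].
by apply: quad_free_through_pair; rewrite ?card_ord.
Qed.
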